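(* Let $h>0$ and $\mathbf t=t_{0:n}$. Then $$M_{0,h\mathbf t,\mathcal J}^{-1}=M_{0,\mathbf t,\mathcal J}^{-1}\,\operatorname{diag}(1,h^{-1},\dots,h^{-r}).$$
   Context: Let $k,r\ge0$ be integers, $\mathcal J=(j_0,\dots,j_r)$ strictly increasing integers with $j_0=0$, $n=j_r+k+1$, and $\mathbf t=t_{0:n}=(t_0,\dots,t_n)$ non-decreasing real knots with $t_j<t_{j+k+1}$ for $j\in\mathcal J$; $h\mathbf t=(ht_0,\dots,ht_n)$. Divided differences: $\Delta(t_i)g=g(t_i)$ and, for $j>i$, $\Delta(t_{i:j})g=(\Delta(t_{i+1:j})g-\Delta(t_{i:j-1})g)/(t_j-t_i)$ if $t_i\ne t_j$, and $=g^{(j-i)}(t_i)/(j-i)!$ if $t_i=t_j$. The reproduction matrix is the $(r+1)\times(r+1)$ matrix $M_{0,\mathbf t,\mathcal J}:=\big[\Delta(t_{j:j+k+1})\,x^{k+1+\delta}\big]_{\delta=0,\dots,r,\ j\in\mathcal J}$ (divided difference of the monomial $x\mapsto x^{k+1+\delta}$), which is invertible under these assumptions. *)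

(* Defs.v *)
From HB Require Import structures.
From mathcomp Require Import all_boot all_order all_algebra.
From mathcomp Require Import all_classical all_reals all_analysis.
Set Implicit Arguments.
Unset Strict Implicit.
Unset Printing Implicit Defensive.
Import Order.TTheory GRing.Theory Num.Theory.
Import numFieldNormedType.Exports.
Local Open Scope ring_scope.
Local Open Scope classical_set_scope.

(* [divdiff g t i m] is the divided difference of g at the m+1 knots
   t_i, ..., t_(i+m). When the two extreme knots coincide it is
   g^(m)(t_i) / m!, which presupposes that t is non-decreasing, so that
   all the knots in between coincide as well. *)
Fixpoint divdiff (R : realType) (g : R -> R) (t : seq R) (i m : nat) : R :=
  if m is m'.+1 then
    if t`_i == t`_(i + m) then derive1n m g t`_i / m`!%:R
    else (divdiff g t i.+1 m' - divdiff g t i m') / (t`_(i + m) - t`_i)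
  else g t`_i.

Definition reproduction_mx (R : realType) (k r : nat) (t : seq R)
    (j : 'I_r.+1 -> nat) : 'M[R]_r.+1 :=
  \matrix_(d < r.+1, a < r.+1)
    divdiff (fun x : R => x ^+ (k.+1 + d)) t (j a) k.+1.

(* Main.v *)
Require Import Defs.
From HB Require Import structures.
From mathcomp Require Import all_boot all_order all_algebra.
From mathcomp Require Import all_classical all_reals all_analysis.
From mathcomp Require Import perm ring zify.
Set Implicit Arguments.
Unset Strict Implicit.
Unset Printing Implicit Defensive.
Import Order.TTheory GRing.Theory Num.Theory.
Import numFieldNormedType.Exports.
Local Open Scope ring_scope.
Local Open Scope classical_set_scope.

(** Write [H i m d] for the divided difference of [x ^+ (m + d)] at the [m + 1]
    knots [t_i, ..., t_(i+m)]; it is the complete homogeneous symmetric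
    polynomial of degree [d] in these knots. Homogeneity gives
    [M (h t) = diag (1, h, ..., h^r) *m M t], so the formula for the inverse is
    immediate as soon as [M t] is invertible. Invertibility is the substance:
    [invmx] is the identity on singular matrices, for which the formula fails in
    general.

    The determinant of [M t] is in fact positive, for any strictly increasing
    choice of the initial indices ([mondiff_det_gt0]). The proof is by
    induction on the size. The row of degree [0] consists of ones
    ([mondiff_eq01]), so that subtracting adjacent columns lowers the size by
    one ([det_row_differences], for the transpose). Since
    [H (i+1) m (d+1) - H i m (d+1) = (t_(i+m+1) - t_i) * H i (m+1) d], the
    difference of two adjacent columns telescopes into a combination, with
    nonnegative weights, of divided differences of order [m + 1] starting
    between the two initial indices ([mondiff_telescope]). Expanding by
    multilinearity, the determinant becomes a sum of nonnegative weights times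
    smaller determinants of the same kind, of order [m + 1]; their initial
    indices are again strictly increasing because they come from consecutive
    disjoint intervals. A term whose weight does not vanish satisfies the
    hypotheses of the induction, hence is positive, and the term that starts at
    the left end of each interval has a positive weight. *)

(** * Determinants *)

(** Subtracting from each row its predecessor turns the column of ones into the
    first basis vector, along which the determinant is expanded. *)
Lemma det_row_differences (R : comNzRingType) n (A : 'M[R]_n.+1) :
  (forall a, A a ord0 = 1) ->
  \det A = \det (\matrix_(a < n, d < n)
    (A (lift ord0 a) (lift ord0 d) - A (widen_ord (leqnSn n) a) (lift ord0 d))).
Proof.
move=> A_col0.
(* Left multiplication by [L] subtracts from each row its predecessor. *)
pose L : 'M[R]_n.+1 := \matrix_(a, b) ((a == b)%:R - (a == b.+1 :> nat)%:R).
have det_L : \det L = 1.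
  rewrite det_trig; last first.
    apply/is_trig_mxP => a b lt_ab; rewrite mxE -val_eqE /= (ltn_eqF lt_ab).
    by rewrite (ltn_eqF (leqW lt_ab)) subrr.
  by apply: big1 => a _; rewrite mxE eqxx (ltn_eqF (leqnn _)) subr0.
have LA_row0 d : (L *m A) ord0 d = A ord0 d.
  rewrite mxE (bigD1 ord0)//= big1 ?addr0 => [|b b_neq0].
    by rewrite mxE eqxx subr0 mul1r.
  by rewrite mxE eq_sym (negPf b_neq0) subrr mul0r.
have LA_rowS a d : (L *m A) (lift ord0 a) d =
    A (lift ord0 a) d - A (widen_ord (leqnSn n) a) d.
  rewrite mxE; under eq_bigr => b _ do rewrite mxE mulrBl.
  rewrite sumrB; congr (_ - _).
    rewrite (bigD1 (lift ord0 a))//= eqxx mul1r big1 ?addr0// => b.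
    by rewrite eq_sym => /negPf ->; rewrite mul0r.
  rewrite (bigD1 (widen_ord (leqnSn n) a))//= /bump /= add1n eqxx mul1r.
  rewrite big1 ?addr0// => b.
  by rewrite eqSS eq_sym -val_eqE /= => /negPf ->; rewrite mul0r.
rewrite -[LHS]mul1r -det_L -det_mulmx (expand_det_col _ ord0) big_ord_recl.
rewrite LA_row0 A_col0 mul1r big1 => [|a _]; last first.
  by rewrite LA_rowS !A_col0 subrr mul0r.
rewrite addr0 /cofactor expr0 mul1r; congr (\det _).
by apply/matrixP => a d; rewrite !mxE -LA_rowS mxE.
Qed.

Lemma det_sum_rows (R : comNzRingType) (I : finType) n
    (G : 'I_n -> I -> 'I_n -> R) :
  \det (\matrix_(a < n, d < n) \sum_i G a i d) =
  \sum_(f : {ffun 'I_n -> I}) \det (\matrix_(a < n, d < n) G a (f a) d).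
Proof.
rewrite /determinant exchange_big /=; apply: eq_bigr => s _.
rewrite -big_distrr /=; congr (_ * _).
under eq_bigr => a _ do rewrite mxE.
rewrite bigA_distr_bigA; apply: eq_bigr => f _.
by apply: eq_bigr => a _; rewrite mxE.
Qed.

Lemma det_scale_rows (R : comNzRingType) n (c : 'I_n -> R)
    (A : 'I_n -> 'I_n -> R) :
  \det (\matrix_(a < n, d < n) (c a * A a d)) =
  (\prod_a c a) * \det (\matrix_(a < n, d < n) A a d).
Proof.
have -> : \matrix_(a < n, d < n) (c a * A a d) =
    diag_mx (\row_a c a) *m \matrix_(a, d) A a d.
  by apply/matrixP => a d; rewrite mul_diag_mx !mxE.
rewrite det_mulmx det_diag; congr (_ * _).
by apply: eq_bigr => a _; rewrite mxE.
Qed.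

(** * Divided differences of monomials *)

Section MonomialDividedDifferences.
Variable R : realType.
Implicit Types (t : seq R) (i m p d : nat).

Local Notation mondiff p t i m := (divdiff (fun x => x ^+ p) t i m).

Lemma derive1n_exprn m p :
  derive1n m (fun x : R => x ^+ p) =
  (fun x => (p ^_ m)%:R * x ^+ (p - m)).
Proof.
elim: m => [|m IHm]; first by apply/funext => x; rewrite derive1n0 mul1r subn0.
rewrite derive1nS IHm; apply/funext => x.
under eq_fun do rewrite mulrC.
rewrite derive1Mr; last exact: exprn_derivable.
by rewrite exp_derive1 /GRing.scale/= ffactnSr natrM subnS; ring.
Qed.

Lemma divdiff_coalesced (g : R -> R) t i m : t`_i = t`_(i + m) ->
  divdiff g t i m = derive1n m g t`_i / m`!%:R.
Proof.
case: m => [|m] /= eq_t; first by rewrite fact0 divr1.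
by rewrite -eq_t eqxx.
Qed.

Lemma mondiff_coalesced p t i m : t`_i = t`_(i + m) ->
  mondiff p t i m = 'C(p, m)%:R * t`_i ^+ (p - m).
Proof.
move=> /divdiff_coalesced ->.
by rewrite derive1n_exprn -bin_ffact natrM mulrAC mulfK//.
Qed.

Lemma knot_le t i j : sorted <=%R t -> (i <= j)%N -> (j < size t)%N ->
  t`_i <= t`_j.
Proof.
move=> t_sorted le_ij lt_j; apply: (sorted_leq_nth le_trans le_refl) => //.
by rewrite inE (leq_ltn_trans le_ij).
Qed.

Lemma knots_coalesced t i j l : sorted <=%R t -> t`_i = t`_l ->
  (i <= j <= l)%N -> (l < size t)%N -> t`_j = t`_i.
Proof.
move=> t_sorted eq_t /andP[le_ij le_jl] lt_l.
by apply/le_anti; rewrite {1}eq_t !knot_le//; exact: leq_ltn_trans lt_l.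
Qed.

(** The recursion that defines divided differences, freed of its case
    distinction: when the extreme knots coincide, all the knots do, and both
    sides vanish. *)
Lemma divdiff_step (g : R -> R) t i m : sorted <=%R t ->
  (i + m.+1 < size t)%N ->
  divdiff g t i.+1 m - divdiff g t i m =
  (t`_(i + m.+1) - t`_i) * divdiff g t i m.+1.
Proof.
move=> t_sorted lt_im /=; case: eqVneq => [eq_t|neq_t]; last first.
  by rewrite mulrC divfK// subr_eq0 eq_sym.
have coal := knots_coalesced t_sorted eq_t.
by rewrite -eq_t subrr mul0r !divdiff_coalesced ?coal ?subrr//; lia.
Qed.

(** The Leibniz rule for the product of [x] and [x ^+ p]. For coalescent
    knots it is Pascal's rule. Otherwise, after multiplication by
    [t_(i+m+1) - t_i], everything of order [m + 1] becomes a difference of order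
    [m], to which the induction hypothesis applies at [i] and at [i + 1]. *)
Lemma mondiffS p t i m : sorted <=%R t -> (i + m.+1 < size t)%N ->
  mondiff p.+1 t i m.+1 =
  t`_i * mondiff p t i m.+1 + mondiff p t i.+1 m.
Proof.
move=> t_sorted; elim: m i => [|m IHm] i lt_im.
  have [eq_t|neq_t] := eqVneq t`_i t`_(i + 1).
    have eq_ti : t`_i.+1 = t`_i by rewrite -addn1.
    rewrite !mondiff_coalesced ?addn0// !bin1 bin0 eq_ti subSS !subn0.
    rewrite -addn1 natrD.
    case: p => [|p]; first by ring.
    by rewrite subn1 /= exprS; ring.
  apply: (@mulfI _ (t`_(i + 1) - t`_i)); first by rewrite subr_eq0 eq_sym.
  rewrite mulrDr mulrCA -!divdiff_step//= addn1 !exprS; ring.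
have [eq_t|neq_t] := eqVneq t`_i t`_(i + m.+2).
  have coal := knots_coalesced t_sorted eq_t.
  have eq_ti : t`_i.+1 = t`_i by rewrite coal//; lia.
  rewrite !mondiff_coalesced// eq_ti; last first.
    by rewrite coal//; lia.
  rewrite subSS binS natrD.
  have [lt_mp|le_pm] := ltnP m.+1 p; last first.
    by rewrite (@bin_small p m.+2)//; ring.
  by rewrite -[(p - m.+1)%N]prednK ?subn_gt0// exprS -subnS; ring.
apply: (@mulfI _ (t`_(i + m.+2) - t`_i)); first by rewrite subr_eq0 eq_sym.
have lt_i1m : (i.+1 + m.+1 < size t)%N by rewrite addSnnS.
have lt_im1 : (i + m.+1 < size t)%N by rewrite ltnW// -addnS.
have step := divdiff_step (fun x => x ^+ p) t_sorted lt_i1m.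
rewrite mulrDr mulrCA -!divdiff_step// !IHm//.
rewrite -addSnnS.
transitivity (t`_i.+1 * mondiff p t i.+1 m.+1 - t`_i * mondiff p t i m.+1 +
  (mondiff p t i.+2 m - mondiff p t i.+1 m)); first by ring.
by rewrite step; ring.
Qed.

(** A divided difference of order [m] kills the polynomials of degree less than
    [m] and takes the leading coefficient of those of degree [m]. *)
Lemma mondiff_eq01 p t i m : sorted <=%R t -> (i + m < size t)%N ->
  (p <= m)%N -> mondiff p t i m = (p == m)%:R.
Proof.
move=> t_sorted; elim: m p i => [|m IHm] p i lt_im.
  by rewrite leqn0 => /eqP ->; rewrite /= expr0.
have lt_i1m : (i.+1 + m < size t)%N by rewrite addSnnS.
have lt_im' : (i + m < size t)%N by rewrite ltnW// -addnS.
elim: p => [|p IHp] le_pm; last first.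
  rewrite mondiffS// IHp ?(ltnW le_pm)// IHm// (ltn_eqF le_pm) mulr0 add0r.
  by rewrite eqSS.
have [eq_t|neq_t] := eqVneq t`_i t`_(i + m.+1).
  by rewrite mondiff_coalesced// bin0n mul0r.
apply: (@mulfI _ (t`_(i + m.+1) - t`_i)); first by rewrite subr_eq0 eq_sym.
by rewrite -divdiff_step// !IHm// subrr mulr0.
Qed.

Lemma mondiff_scale (h : R) p t i m : h != 0 -> (m <= p)%N ->
  mondiff p [seq h * x | x <- t] i m = h ^+ (p - m) * mondiff p t i m.
Proof.
move=> h_neq0.
(* Beyond the last knot both sides are the default value [0]. *)
have nth_ht l : [seq h * x | x <- t]`_l = h * t`_l.
  have [lt_l|ge_l] := ltnP l (size t); first exact: nth_map.
  by rewrite !nth_default ?mulr0 ?size_map.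
elim: m i => [|m IHm] i le_mp; first by rewrite /= nth_ht exprMn subn0.
have [eq_t|neq_t] := eqVneq t`_i t`_(i + m.+1).
  by rewrite !mondiff_coalesced ?nth_ht ?eq_t// exprMn mulrCA.
rewrite /= !nth_ht (inj_eq (mulfI h_neq0)) (negPf neq_t) !IHm ?(ltnW le_mp)//.
rewrite -[(p - m)%N]prednK ?subn_gt0// -subnS exprS.
field.
by rewrite -mulrBr mulf_eq0 negb_or h_neq0 !subr_eq0 eq_sym neq_t.
Qed.

(** * Positivity of the determinant *)

Lemma ordinal_mono_leq n (j : 'I_n -> nat) :
  (forall a b : 'I_n, (a < b)%N -> (j a < j b)%N) ->
  forall a b : 'I_n, (a <= b)%N -> (j a <= j b)%N.
Proof.
move=> j_incr a b; rewrite leq_eqVlt => /orP[/eqP/val_inj -> //|/j_incr].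
exact: ltnW.
Qed.

(** The sum is extended to all the indices of [t], with zero weights outside of
    [lo <= i < hi], so that the range does not depend on the row when
    [det_sum_rows] is applied. *)
Lemma mondiff_telescope t m d lo hi : sorted <=%R t -> (lo <= hi)%N ->
  (hi + m < size t)%N ->
  mondiff (m + d.+1) t hi m - mondiff (m + d.+1) t lo m =
  \sum_(i < size t) (if (lo <= i < hi)%N then t`_(i + m.+1) - t`_i else 0) *
    mondiff (m.+1 + d) t i m.+1.
Proof.
move=> t_sorted le_lohi lt_him.
under eq_bigr => i _ do rewrite (fun_if (fun c => c * _)) mul0r.
rewrite -big_mkcond /= -(big_mkord (fun i => (lo <= i < hi)%N)
  (fun i => (t`_(i + m.+1) - t`_i) * mondiff (m.+1 + d) t i m.+1)).
rewrite -(big_nat_widen 0 hi (size t) (fun i => (lo <= i)%N)); last by lia.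
rewrite -(big_nat_widenl lo 0 hi predT)//.
rewrite -(telescope_sumr (fun i => mondiff (m + d.+1) t i m))//.
apply: eq_big_nat => i /andP[le_i lt_i].
by rewrite addSnnS divdiff_step//; lia.
Qed.

(** The determinant is a sum of terms of the same form, one row smaller and of
    one order higher, with nonnegative weights that do not all vanish. Hence the
    induction on the size, with an arbitrary order. *)
Lemma mondiff_det_gt0 t r m (j : 'I_r.+1 -> nat) : sorted <=%R t ->
  (forall a b : 'I_r.+1, (a < b)%N -> (j a < j b)%N) ->
  (forall a, j a + m < size t)%N ->
  (forall a, t`_(j a) < t`_(j a + m)) ->
  0 < \det (\matrix_(a < r.+1, d < r.+1) mondiff (m + d) t (j a) m).
Proof.
move=> t_sorted; elim: r m j => [|r IHr] m j j_incr lt_jm t_lt.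
  by rewrite det_mx11 mxE mondiff_eq01// ?addn0// eqxx ltr01.
rewrite det_row_differences => [|a]; last first.
  by rewrite mxE mondiff_eq01// ?addn0// eqxx.
pose lo (a : 'I_r.+1) := j (widen_ord (leqnSn r.+1) a).
pose hi (a : 'I_r.+1) := j (lift ord0 a).
have lt_lohi a : (lo a < hi a)%N by apply: j_incr.
pose w a i := if (lo a <= i < hi a)%N then t`_(i + m.+1) - t`_i else 0.
have -> : \matrix_(a < r.+1, d < r.+1)
      ((\matrix_(a < r.+2, d < r.+2) mondiff (m + d) t (j a) m)
         (lift ord0 a) (lift ord0 d) -
       (\matrix_(a < r.+2, d < r.+2) mondiff (m + d) t (j a) m)
         (widen_ord (leqnSn r.+1) a) (lift ord0 d)) =
    \matrix_(a < r.+1, d < r.+1) \sum_(i < size t)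
       w a i * mondiff (m.+1 + d) t i m.+1.
  apply/matrixP => a d; rewrite !mxE lift0.
  exact: (mondiff_telescope d t_sorted (ltnW (lt_lohi a)) (lt_jm _)).
rewrite (det_sum_rows
  (fun (a : 'I_r.+1) (i : 'I_(size t)) (d : 'I_r.+1) =>
    w a i * mondiff (m.+1 + d) t i m.+1)).
under eq_bigr => f _ do
  rewrite (det_scale_rows (fun a => w a (f a))
    (fun a (d : 'I_r.+1) => mondiff (m.+1 + d) t (f a) m.+1)).
have w_ge0 a i : 0 <= w a i.
  rewrite /w; case: ifP => // /andP[_ lt_i].
  rewrite subr_ge0 knot_le// ?leq_addr//.
  by move: (lt_jm (lift ord0 a)); rewrite -/(hi a); lia.
have minor_gt0 (f : {ffun 'I_r.+1 -> 'I_(size t)}) :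
    (forall a, w a (f a) != 0) ->
    0 < \det (\matrix_(a < r.+1, d < r.+1) mondiff (m.+1 + d) t (f a) m.+1).
  move=> w_neq0.
  have f_in a : (lo a <= f a < hi a)%N.
    by move: (w_neq0 a); rewrite /w; case: ifP => //; rewrite eqxx.
  apply: (IHr m.+1 (fun a => f a)) => [a b lt_ab|a|a].
  - have /andP[_ lt_fa] := f_in a; have /andP[le_fb _] := f_in b.
    (* [f a < hi a <= lo b <= f b] *)
    apply: leq_trans lt_fa (leq_trans _ le_fb).
    by apply: (ordinal_mono_leq j_incr); rewrite lift0.
  - by have := f_in a; move: (lt_jm (lift ord0 a)); rewrite -/(hi a); lia.
  - have := w_ge0 a (f a); rewrite le_eqVlt eq_sym (negPf (w_neq0 a)) /=.
    by rewrite /w f_in subr_gt0.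
have lt_lo a : (lo a < size t)%N.
  exact: leq_ltn_trans (leq_addr m _) (lt_jm _).
(* The term with positive weights:
   [t_(lo a) < t_(lo a + m) <= t_(lo a + m + 1)]. *)
pose f0 : {ffun 'I_r.+1 -> 'I_(size t)} := [ffun a => Ordinal (lt_lo a)].
have w_f0_gt0 a : 0 < w a (f0 a).
  rewrite ffunE /w /= leqnn lt_lohi subr_gt0.
  apply: lt_le_trans (t_lt _) _; rewrite knot_le//; first by rewrite leq_add2l.
  by have := lt_lohi a; move: (lt_jm (lift ord0 a)); rewrite -/(hi a); lia.
rewrite (bigD1 f0)//=; apply: ltr_wpDr; last first.
  by rewrite mulr_gt0 ?prodr_gt0// minor_gt0// => a; rewrite gt_eqF.
apply: sumr_ge0 => f _.
have [/existsP[a /eqP w0]|/existsPn w_neq0] :=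
  boolP [exists a, w a (f a) == 0].
  by rewrite (bigD1 a)//= w0 !mul0r.
by rewrite mulr_ge0 ?prodr_ge0// ltW// minor_gt0.
Qed.

End MonomialDividedDifferences.

(** * Scaling the knots *)

Lemma reproduction_mx_scale (R : realType) k r (t : seq R)
    (j : 'I_r.+1 -> nat) (h : R) : h != 0 ->
  reproduction_mx k [seq h * x | x <- t] j =
  diag_mx (\row_(i < r.+1) h ^+ i) *m reproduction_mx k t j.
Proof.
move=> h_neq0; apply/matrixP => d a; rewrite mul_diag_mx !mxE.
by rewrite mondiff_scale ?leq_addr// addKn.
Qed.

Theorem lemma3p4 (R : realType) (k r : nat) (j : 'I_r.+1 -> nat)
  (j_incr : forall a b : 'I_r.+1, (a < b)%N -> (j a < j b)%N)
  (j_0 : j ord0 = 0%N)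
  (n : nat) (n_def : n = (j ord_max + k + 1)%N)
  (t : n.+1.-tuple R) (t_sorted : sorted <=%R t)
  (t_knots : forall a : 'I_r.+1, t`_(j a) < t`_(j a + k + 1))
  (h : R) (h_gt0 : 0 < h) :
  invmx (reproduction_mx k [seq h * x | x <- t] j) =
  invmx (reproduction_mx k t j) *m diag_mx (\row_(i < r.+1) h ^- i).
Proof.
have h_neq0 : h != 0 by rewrite gt_eqF.
have M_unit : reproduction_mx k t j \in unitmx.
  rewrite -unitmx_tr unitmxE unitfE gt_eqF//.
  have -> : (reproduction_mx k t j)^T = \matrix_(a < r.+1, d < r.+1)
      divdiff (fun x : R => x ^+ (k.+1 + d)) t (j a) k.+1.
    by apply/matrixP => a d; rewrite !mxE.
  apply: mondiff_det_gt0 => // a; last first.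
    by have := t_knots a; rewrite -addnA addn1.
  rewrite size_tuple n_def.
  have := ordinal_mono_leq j_incr (leq_ord a : (a <= @ord_max r)%N); lia.
pose D : 'M[R]_r.+1 := diag_mx (\row_(i < r.+1) h ^+ i).
pose D' : 'M[R]_r.+1 := diag_mx (\row_(i < r.+1) h ^- i).
have D'D : D' *m D = 1%:M.
  apply/matrixP => a b; rewrite mul_diag_mx !mxE.
  by case: eqP => _; rewrite ?mulr1n ?mulr0n ?mulr0// mulVf// expf_neq0.
rewrite reproduction_mx_scale// -/D -/D'.
have left_inv : invmx (reproduction_mx k t j) *m D' *m
    (D *m reproduction_mx k t j) = 1%:M.
  by rewrite mulmxA -(mulmxA _ D') D'D mulmx1 mulVmx.
have [_ DM_unit] := mulmx1_unit left_inv.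
by rewrite -[RHS]mulmx1 -(mulmxV DM_unit) mulmxA left_inv mul1mx.
Qed.
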